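(* Let $\mathbb{T}$ be the circle of length $2\pi$, let $k_0:\mathbb{T}\to[0,\infty)$, $c:\mathbb{T}\times[0,\infty)\to[0,\infty)$ and $A:\mathbb{R}^+\to\mathbb{R}^+$ (with $\mathbb{R}^+=[0,\infty)$) be continuous, and suppose there exists $A_+>0$ such that $A(t)\ge A_+$ for all $t\ge0$. Assume that $$k_0(x)\ \ge\ \int_0^t e^{-\int_0^sA(z)\,dz}\max_{y\in\mathbb{T}}c(y,s)\,ds\qquad\text{for all }x\in\mathbb{T},\ t\ge0 .$$ Let $k(x,t)$ be the classical positive solution of $$k_t=k_{xx}+A(t)k-c(x,t),\qquad k(x,0)=k_0(x).$$ Set $$\widetilde{k}_0=\frac1{\pi}\int_{-\pi}^{\pi}k_0(x)\,dx,\qquad \widetilde{c}(t)=\frac1{\pi}\int_{-\pi}^{\pi}c(x,t)\,dx ,$$ and assume that $\widetilde c$ is bounded. Then $$\lim_{t\to\infty}\left[k(x,t)e^{-\int_0^tA(s)\,ds}\right]=\widetilde{k}_0-\int_0^\infty e^{-\int_0^sA(z)\,dz}\,\widetilde{c}(s)\,ds$$ uniformly in $x\in\mathbb{T}$.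
   Context: $\mathbb{T}$ is $[0,2\pi]$ with endpoints identified; functions on $\mathbb{T}$ are identified with $2\pi$-periodic functions of $x$. A classical solution is a function continuous on $\mathbb{T}\times[0,\infty)$, twice continuously differentiable in $x$ (and differentiable in $t$) for $t>0$, satisfying the partial differential equation for all $x\in\mathbb{T}$, $t>0$, and the initial condition at $t=0$.
   Formalization: The factor 1/π in the definitions of k̃_0 and c̃ is replaced by 1/(2π), because with 1/π the stated limit is twice the true one (c=0, A=1, k_0=1 gives k=e^t, with limit 1 and not 2). *)

(* Defs.v *)
(* Stdlib reals with Coquelicot.  The circle is encoded by 2 PI-periodic
   functions on R, and functions of t in [0, oo) by total functions on R about
   which nothing is assumed for t < 0. *)
From Stdlib Require Import Reals ZArith Lra Lia.
From Coquelicot Require Import Coquelicot.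

Set Implicit Arguments.
Unset Strict Implicit.
Open Scope R_scope.

Definition periodic (f : R -> R) : Prop := forall x, f (x + 2 * PI) = f x.

Definition nonneg_time (t : R) : Prop := 0 <= t.

(* Normalised by the full length 2 PI, so that the mean of a constant is that
   constant.  With the factor 1 / PI the asserted limit would be twice the true
   one: for c = 0, k0 = 1, A = 1 the solution is exp t, and the limit is 1. *)
Definition circle_mean (f : R -> R) : R := / (2 * PI) * RInt f (- PI) PI.

(* A supremum in general; [circle_max_spec] shows it is a maximum for
   continuous periodic functions. *)
Definition circle_max (f : R -> R) : R :=
  real (Lub_Rbar (fun r => exists y, r = f y)).

Definition discount (A : R -> R) (t : R) : R := exp (- RInt A 0 t).

Definition continuous_circle_time (f : R -> R -> R) : Prop :=
  continuous_on (fun p : R * R => nonneg_time (snd p))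
                (fun p : R * R => f (fst p) (snd p)).

(* The spatial second derivative is required to be continuous in x at each
   fixed t > 0, not jointly in (x, t).  The differentiability clauses are
   separate because [Derive] is total. *)
Record classical_solution (A : R -> R) (c : R -> R -> R) (k0 : R -> R)
    (k : R -> R -> R) : Prop := {
  sol_periodic : forall t, 0 <= t -> periodic (fun x => k x t);
  sol_continuous : continuous_circle_time k;
  sol_diff_x : forall x t, 0 < t -> ex_derive (fun y => k y t) x;
  sol_diff_xx : forall x t, 0 < t -> ex_derive (Derive (fun y => k y t)) x;
  sol_cont_xx : forall x t, 0 < t ->
    continuous (Derive_n (fun y => k y t) 2) x;
  sol_diff_t : forall x t, 0 < t -> ex_derive (fun s => k x s) t;
  sol_pde : forall x t, 0 < t ->
    Derive (fun s => k x s) t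
    = Derive_n (fun y => k y t) 2 x + A t * k x t - c x t;
  sol_init : forall x, k x 0 = k0 x
}.

Definition uniform_limit_at_infinity (u : R -> R -> R) (l : R) : Prop :=
  forall eps, 0 < eps ->
    exists T, 0 <= T /\ forall t, T <= t -> forall x, Rabs (u x t - l) < eps.

Lemma periodic_nat (f : R -> R) (n : nat) (x : R) :
  periodic f -> f (x + INR n * (2 * PI)) = f x.
Proof.
intros Hp; induction n as [|n IH].
- simpl; f_equal; ring.
- rewrite S_INR, <- IH, <- (Hp (x + INR n * (2 * PI))); f_equal; ring.
Qed.

Lemma periodic_reduce (f : R -> R) (x : R) :
  periodic f -> exists y, 0 <= y <= 2 * PI /\ f y = f x.
Proof.
intros Hp.
assert (HP : 0 < 2 * PI) by (generalize PI_RGT_0; lra).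
destruct (archimed (x / (2 * PI))) as [H1 H2].
set (z := (up (x / (2 * PI)) - 1)%Z).
assert (Hz : IZR z = IZR (up (x / (2 * PI))) - 1)
  by (unfold z; rewrite minus_IZR; ring).
assert (Hx : x = x / (2 * PI) * (2 * PI)) by (field; lra).
exists (x - IZR z * (2 * PI)); split.
- set (q := x / (2 * PI)) in *; rewrite Hx; split; nra.
- destruct (Z_le_gt_dec 0 z) as [Hs|Hs].
  + destruct (IZN z Hs) as [n Hn]; rewrite Hn, <- INR_IZR_INZ.
    rewrite <- (@periodic_nat f n (x - INR n * (2 * PI)) Hp); f_equal; ring.
  + destruct (IZN (- z)%Z) as [n Hn]; [lia|].
    replace z with (- Z.of_nat n)%Z by lia.
    rewrite opp_IZR, <- INR_IZR_INZ.
    rewrite <- (@periodic_nat f n x Hp); f_equal; ring.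
Qed.

Lemma circle_max_spec (f : R -> R) :
  periodic f -> (forall x, continuous f x) ->
  (exists y, f y = circle_max f) /\ forall y, f y <= circle_max f.
Proof.
intros Hp Hc.
destruct (continuity_ab_maj f 0 (2 * PI)) as [m [Hm _]].
- generalize PI_RGT_0; lra.
- intros y _; apply continuity_pt_filterlim, Hc.
- assert (Hall : forall y, f y <= f m).
  { intros y; destruct (periodic_reduce y Hp) as [w [Hw <-]]; auto. }
  assert (E : circle_max f = f m).
  { unfold circle_max.
    rewrite (is_lub_Rbar_unique (fun r => exists y, r = f y) (f m)).
    - reflexivity.
    - split.
      + intros r [y ->]; apply Hall.
      + intros b Hb; apply Hb; exists m; reflexivity. }
  rewrite E; split; [now exists m | exact Hall].
Qed.

(* Main.v *)
Require Import Defs.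
From Stdlib Require Import Reals Lra Lia Classical.
From Coquelicot Require Import Coquelicot.
Open Scope R_scope.

(* With D the discount factor, u = D k solves u_t = u_xx - D c.  By k0_large the
   sup norm m(t) of the source D c is integrable on [0, oo), so it suffices to
   show that the spatial mean of u evolves by the mean of the source, and that
   the oscillation of u tends to 0.  Both follow from the maximum principle
   alone: the first for averages of finitely many equispaced translates of u,
   the second for u(x,t) - u(2p-x,t) on [p, p + PI], where a multiple of
   exp(-4t/9) cos(2(x-p)/3 - PI/3) + int m is a barrier. *)

(** * Maximum principle *)

(** The obstacle is regularity: derivatives exist only for t > 0, and the hypotheses give neither a
    bound on them as t tends to 0 nor joint continuity, so Fourier coefficients and energies cannot
    be differentiated without further estimates. Comparison needs pointwise derivatives only.

    The frequency 2/3 is a compromise. The natural mode sin(x - p), of rate 1, vanishes at p and p +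
    PI, so a multiple of it need not dominate merely continuous data that vanish there. A frequency
    below 1 keeps a centred cosine positive on the closed interval; with 2/3 its argument runs over
    [- PI/3, PI/3], where cos >= 1/2, and the rate is (2/3)^2 = 4/9.

    The estimate is restarted at a late time T1: the oscillation present at T1 decays exponentially,
    and the source adds at most the integral of m after T1. Comparison being pointwise, it is the
    tail of the sup norm, rather than of the mean, that has to be small. *)

Definition jointly_continuous (u : R -> R -> R) : Prop :=
  forall x t, continuous (fun p : R * R => u (fst p) (snd p)) (x, t).

Lemma jointly_continuous_comp (u : R -> R -> R) (g h : R * R -> R) p :
  jointly_continuous u -> continuous g p -> continuous h p ->
  continuous (fun p => u (g p) (h p)) p.
Proof. intros Hu Hg Hh; apply (continuous_comp_2 g h u); auto; apply Hu. Qed.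

Lemma jointly_continuous_l (u : R -> R -> R) t x :
  jointly_continuous u -> continuous (fun y => u y t) x.
Proof.
intros Hu; apply (continuous_comp_2 (fun y => y) (fun _ => t) u).
- apply continuous_id.
- apply continuous_const.
- apply Hu.
Qed.

Lemma jointly_continuous_uniform (u : R -> R -> R) a b s T eps :
  jointly_continuous u -> 0 < eps ->
  exists delta, 0 < delta /\ forall x t x' t',
    a <= x <= b -> s <= t <= T -> a <= x' <= b -> s <= t' <= T ->
    Rabs (x' - x) < delta -> Rabs (t' - t) < delta ->
    Rabs (u x' t' - u x t) < eps.
Proof.
intros Hu He.
destruct (uniform_continuity_2d u a b s T) with (eps := mkposreal eps He)
  as [delta Hd].
- intros x t _ _; apply continuity_2d_pt_filterlim, Hu.
- exists delta; split; [apply cond_pos|].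
  intros x t x' t' H1 H2 H3 H4 H5 H6; apply Hd; auto.
Qed.

Lemma jointly_continuous_uniform_periodic (u : R -> R -> R) s T eps :
  jointly_continuous u -> (forall t, periodic (fun x => u x t)) -> 0 < eps ->
  exists delta, 0 < delta /\ forall x t x' t',
    s <= t <= T -> s <= t' <= T ->
    Rabs (x' - x) < delta -> Rabs (t' - t) < delta ->
    Rabs (u x' t' - u x t) < eps.
Proof.
intros Hu Hp He.
destruct (@jointly_continuous_uniform u (-1) (2 * PI + 1) s T eps Hu He)
  as [d [Hd H]].
exists (Rmin d 1); split; [apply Rmin_pos; lra|].
intros x t x' t' Ht Ht' Hx Htt.
assert (L1 := Rmin_l d 1); assert (L2 := Rmin_r d 1).
(* With the shift x' - x frozen, the increment is periodic in x. Moving x into [0, 2 PI] leaves x'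
   within distance 1 of it, hence the margin of the rectangle. *)
set (g := fun y => u (y + (x' - x)) t' - u y t).
assert (Hg : periodic g).
{ intros y; unfold g; rewrite (Hp t y); f_equal.
  rewrite <- (Hp t' (y + (x' - x))); f_equal; ring. }
destruct (periodic_reduce x Hg) as [y [Hy E]].
replace (u x' t' - u x t) with (g y).
- apply Rabs_def2 in Hx as Hx'.
  apply H; try lra; replace (y + (x' - x) - y) with (x' - x) by ring; lra.
- rewrite E; unfold g; f_equal; f_equal; ring.
Qed.

(** Maximise in x first. The slice maximum is continuous in t by uniform continuity, since a
    maximiser at one time is a competitor at the other; then maximise in t. *)
Lemma rectangle_max (u : R -> R -> R) a b s T :
  jointly_continuous u -> a <= b -> s <= T ->
  exists x t, a <= x <= b /\ s <= t <= T /\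
    forall y r, a <= y <= b -> s <= r <= T -> u y r <= u x t.
Proof.
intros Hu Hab HsT.
assert (Hex : forall t, exists x, a <= x <= b /\
  forall y, a <= y <= b -> u y t <= u x t).
{ intros t; destruct (continuity_ab_maj (fun x => u x t) a b Hab) as [x [H1 H2]].
  - intros x _; apply continuity_pt_filterlim.
    exact (@jointly_continuous_l u t x Hu).
  - exists x; auto. }
(* A supremum defines M without choosing a maximiser for each t. *)
set (M := fun t => real (Lub_Rbar (fun r => exists y, a <= y <= b /\ r = u y t))).
assert (HM : forall t, (exists x, a <= x <= b /\ u x t = M t) /\
  forall y, a <= y <= b -> u y t <= M t).
{ intros t; destruct (Hex t) as [x [Hx Hmax]].
  assert (E : M t = u x t).
  { unfold M; rewrite (is_lub_Rbar_unique _ (u x t)); [reflexivity|split].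
    - intros r [y [Hy ->]]; apply Hmax, Hy.
    - intros B HB; apply HB; exists x; auto. }
  rewrite E; split; [exists x|]; auto. }
destruct (continuity_ab_maj M s T HsT) as [t [Ht1 Ht2]].
- intros t Ht; apply continuity_pt_locally; intros eps.
  destruct (@jointly_continuous_uniform u a b (s - 1) (T + 1) eps Hu (cond_pos eps))
    as [d [Hd H]].
  assert (Hd1 : 0 < Rmin d 1) by (apply Rmin_pos; lra).
  exists (mkposreal _ Hd1); intros r Hr.
  change (Rabs (r - t) < Rmin d 1) in Hr.
  assert (L1 := Rmin_l d 1); assert (L2 := Rmin_r d 1).
  apply Rabs_def2 in Hr as Hr'.
  destruct (HM t) as [[x [Hx Ex]] Bx]; destruct (HM r) as [[y [Hy Ey]] By].
  assert (E1 : Rabs (u x r - u x t) < eps)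
    by (apply H; try lra; rewrite Rminus_diag, Rabs_R0; lra).
  assert (E2 : Rabs (u y r - u y t) < eps)
    by (apply H; try lra; rewrite Rminus_diag, Rabs_R0; lra).
  apply Rabs_def2 in E1; apply Rabs_def2 in E2.
  specialize (Bx y Hy); specialize (By x Hx).
  apply Rabs_def1; lra.
- destruct (HM t) as [[x [Hx Ex]] _].
  exists x, t; repeat split; try lra.
  intros y r Hy Hr; rewrite Ex.
  apply Rle_trans with (M r); [apply HM, Hy | apply Ht1, Hr].
Qed.

(** Only earlier times are compared, because the maximum in the comparison argument may sit at the
    final time. *)
Lemma is_derive_ge_0_left (g : R -> R) s t l :
  s < t -> is_derive g t l -> (forall r, s <= r <= t -> g r <= g t) -> 0 <= l.
Proof.
intros Hst Hg Hmax; apply is_derive_Reals in Hg.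
destruct (Rle_lt_dec 0 l) as [|Hl]; [assumption|exfalso].
destruct (Hg (- l)) as [d Hd]; [lra|].
set (h := - Rmin (d / 2) (t - s)).
assert (Hm : 0 < Rmin (d / 2) (t - s))
  by (apply Rmin_pos; [generalize (cond_pos d)|]; lra).
assert (L1 := Rmin_l (d / 2) (t - s)); assert (L2 := Rmin_r (d / 2) (t - s)).
assert (Hh : Rabs ((g (t + h) - g t) / h - l) < - l).
{ apply Hd; unfold h; [lra|].
  rewrite Rabs_Ropp, Rabs_right; generalize (cond_pos d); lra. }
apply Rabs_def2 in Hh.
assert (Hle : g (t + h) <= g t) by (apply Hmax; unfold h; lra).
assert (0 <= (g (t + h) - g t) / h); [|lra].
replace ((g (t + h) - g t) / h) with ((g t - g (t + h)) / - h)
  by (field; unfold h; lra).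
apply Rdiv_le_0_compat; unfold h in *; lra.
Qed.

(** If q > 0, the difference quotients of [d1] at the critical point x make [d1] positive just to
    the right of x, and the mean value theorem yields a value above g x. *)
Lemma second_derivative_test (g d1 : R -> R) x q :
  (forall y, is_derive g y (d1 y)) -> is_derive d1 x q ->
  locally x (fun y => g y <= g x) -> q <= 0.
Proof.
intros Hg Hd1 [d Hmax].
assert (dp := cond_pos d).
assert (Hm : forall y, Rabs (y - x) < d -> g y <= g x) by exact Hmax.
assert (H0 : d1 x = 0).
{ apply Rle_antisym.
  (* The mirrored function turns the right-hand neighbourhood of x into a left-hand one. *)
  - assert (0 <= - d1 x); [|lra].
    apply (@is_derive_ge_0_left (fun z => g (- z)) (- x - d / 2) (- x)); [lra| |].
    + replace (- d1 x) with (scal (- 1) (d1 (- - x)))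
        by (unfold scal; simpl; unfold mult; simpl; rewrite Ropp_involutive; ring).
      apply (is_derive_comp g Ropp); [apply Hg|].
      auto_derive; auto; ring.
    + intros r Hr; rewrite Ropp_involutive; apply Hm, Rabs_def1; lra.
  - apply (@is_derive_ge_0_left g (x - d / 2) x); [lra|apply Hg|].
    intros r Hr; apply Hm, Rabs_def1; lra. }
destruct (Rle_lt_dec q 0) as [|Hq]; [assumption|exfalso].
apply is_derive_Reals in Hd1; destruct (Hd1 q Hq) as [e He].
assert (ep := cond_pos e).
set (h := Rmin (d / 2) (e / 2)).
assert (Hh : 0 < h) by (apply Rmin_pos; lra).
assert (L1 := Rmin_l (d / 2) (e / 2) : h <= d / 2).
assert (L2 := Rmin_r (d / 2) (e / 2) : h <= e / 2).
destruct (MVT_cor2 g d1 x (x + h)) as [z [E Hz]]; [lra| |].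
- intros z _; apply is_derive_Reals, Hg.
- assert (Hle : g (x + h) <= g x) by (apply Hm, Rabs_def1; lra).
  specialize (He (z - x)); rewrite H0 in He.
  replace (x + (z - x)) with z in He by ring.
  assert (Hz1 : Rabs ((d1 z - 0) / (z - x) - q) < q)
    by (apply He; [lra | apply Rabs_def1; lra]).
  apply Rabs_def2 in Hz1.
  assert (Hpos : 0 < (d1 z - 0) / (z - x)) by lra.
  assert (0 < d1 z).
  { replace (d1 z) with ((d1 z - 0) / (z - x) * (z - x)) by (field; lra).
    apply Rmult_lt_0_compat; lra. }
  nra.
Qed.

(** Derivatives are witnesses rather than values of the total [Derive], so that linear combinations
    and isometries act on them directly; q is u_xx at the single point (x, t), and f is the
    source. *)
Definition heat_solution (u f : R -> R -> R) : Prop :=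
  forall x t, 0 < t -> exists (d1 : R -> R) (q : R),
    (forall y, is_derive (fun z => u z t) y (d1 y)) /\
    is_derive d1 x q /\
    is_derive (fun s => u x s) t (q + f x t).

Lemma heat_solution_ext (u f v g : R -> R -> R) :
  (forall x t, u x t = v x t) -> (forall x t, f x t = g x t) ->
  heat_solution u f -> heat_solution v g.
Proof.
intros Huv Hfg H x t Ht; destruct (H x t Ht) as [d1 [q [H1 [H2 H3]]]].
exists d1, q; split; [|split; [exact H2|]].
- intros y; apply is_derive_ext with (2 := H1 y); auto.
- rewrite <- Hfg; apply is_derive_ext with (2 := H3); auto.
Qed.

Lemma heat_solution_lin (a b : R) (u f v g : R -> R -> R) :
  heat_solution u f -> heat_solution v g ->
  heat_solution (fun x t => a * u x t + b * v x t)
                (fun x t => a * f x t + b * g x t).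
Proof.
intros Hu Hv x t Ht.
destruct (Hu x t Ht) as [d1 [q [H1 [H2 H3]]]].
destruct (Hv x t Ht) as [d1' [q' [H1' [H2' H3']]]].
exists (fun y => a * d1 y + b * d1' y), (a * q + b * q'); split; [|split].
- intros y; apply (is_derive_plus (fun z => a * u z t)); apply is_derive_scal; auto.
- apply (is_derive_plus (fun z => a * d1 z)); apply is_derive_scal; auto.
- replace (a * q + b * q' + (a * f x t + b * g x t))
    with (a * (q + f x t) + b * (q' + g x t)) by ring.
  apply (is_derive_plus (fun z => a * u x z)); apply is_derive_scal; auto.
Qed.

Lemma heat_solution_time (g dg : R -> R) :
  (forall t, 0 < t -> is_derive g t (dg t)) ->
  heat_solution (fun _ t => g t) (fun _ t => dg t).
Proof.
intros Hg x t Ht; exists (fun _ => 0), 0; split; [|split].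
- intros y; apply (is_derive_const (g t)).
- apply (is_derive_const 0).
- rewrite Rplus_0_l; auto.
Qed.

Lemma is_derive_comp_affine (g : R -> R) l m x dg :
  is_derive g (l + m * x) dg -> is_derive (fun y => g (l + m * y)) x (m * dg).
Proof.
intros Hg; apply (is_derive_comp g (fun y => l + m * y)); auto.
auto_derive; auto; ring.
Qed.

(** The second derivative picks up the factor m * m. The case m = 1 serves the translates behind the
    mean, m = -1 the reflection behind the oscillation. *)
Lemma heat_solution_isometry (l m : R) (u f : R -> R -> R) :
  m * m = 1 -> heat_solution u f ->
  heat_solution (fun x t => u (l + m * x) t) (fun x t => f (l + m * x) t).
Proof.
intros Hm Hu x t Ht.
destruct (Hu (l + m * x) t Ht) as [d1 [q [H1 [H2 H3]]]].
exists (fun y => m * d1 (l + m * y)), q; split; [|split; auto].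
- intros y; apply (@is_derive_comp_affine (fun z => u z t)), H1.
- replace q with (m * (m * q)) by (rewrite <- Rmult_assoc, Hm; ring).
  apply (is_derive_scal (fun y => d1 (l + m * y))), is_derive_comp_affine, H2.
Qed.

(* The last hypothesis lets the periodic and the Dirichlet problem share one
   proof: it only asks that positive maxima over [a, b] be local maxima. *)
Lemma max_principle (u f : R -> R -> R) a b s T :
  a <= b -> 0 <= s -> s <= T -> jointly_continuous u -> heat_solution u f ->
  (forall x t, a <= x <= b -> s < t <= T -> f x t <= 0) ->
  (forall x, a <= x <= b -> u x s <= 0) ->
  (forall x t, a <= x <= b -> s < t <= T -> 0 < u x t ->
     (forall y, a <= y <= b -> u y t <= u x t) ->
     locally x (fun y => u y t <= u x t)) ->
  forall x t, a <= x <= b -> s <= t <= T -> u x t <= 0.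
Proof.
intros Hab Hs HsT Hu Hheat Hf Hinit Hloc x0 t0 Hx0 Ht0.
destruct (Rle_lt_dec (u x0 t0) 0) as [|Hpos]; [assumption|exfalso].
(* Subtracting e * (t - s) makes the source strictly negative; this e leaves exactly the value e > 0
   at (x0, t0), so the maximum of the modified function stays positive. *)
set (e := u x0 t0 / (t0 - s + 1)).
assert (He : 0 < e) by (apply Rdiv_lt_0_compat; lra).
assert (Ee : e * (t0 - s) = u x0 t0 - e) by (unfold e; field; lra).
destruct (@rectangle_max (fun x t => u x t - e * (t - s)) a b s T)
  as [x [t [Hx [Ht Hmax]]]]; auto.
{ intros x t.
  apply (continuous_minus (fun p : R * R => u (fst p) (snd p))); [apply Hu|].
  apply (continuous_scal_r e (fun p : R * R => snd p - s)).
  apply (continuous_minus (fun p : R * R => snd p));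
    [apply continuous_snd | apply continuous_const]. }
assert (H0 := Hmax x0 t0 Hx0 Ht0); simpl in H0.
assert (Hts : s < t).
{ destruct (Req_dec s t) as [<-|]; [|lra].
  specialize (Hinit x Hx); lra. }
assert (Hux : 0 < u x t) by nra.
destruct (Hheat x t) as [d1 [q [H1 [H2 H3]]]]; [lra|].
assert (Hq : q <= 0).
{ apply (@second_derivative_test (fun z => u z t) d1 x q); auto.
  apply Hloc; auto; try lra.
  intros y Hy; assert (H := Hmax y t Hy Ht); simpl in H; lra. }
assert (Hd : 0 <= q + f x t - e).
{ apply (@is_derive_ge_0_left (fun r => u x r - e * (r - s)) s t); auto.
  - apply (is_derive_minus (fun r => u x r) (fun r => e * (r - s))); auto.
    auto_derive; auto; ring.
  - intros r Hr; apply Hmax; auto; lra. }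
specialize (Hf x t Hx); lra.
Qed.

Lemma max_principle_periodic (u f : R -> R -> R) s T :
  0 <= s -> s <= T -> jointly_continuous u -> heat_solution u f ->
  (forall t, periodic (fun x => u x t)) ->
  (forall x t, s < t <= T -> f x t <= 0) -> (forall x, u x s <= 0) ->
  forall x, u x T <= 0.
Proof.
intros Hs HsT Hu Hheat Hp Hf Hinit x.
destruct (periodic_reduce x (Hp T)) as [y [Hy <-]].
apply (@max_principle u f 0 (2 * PI) s T); auto; try lra.
(* A maximum over one period is global, so any radius will do. *)
intros z t Hz Ht _ Hmax; exists (mkposreal 1 Rlt_0_1); intros r _.
destruct (periodic_reduce r (Hp t)) as [r' [Hr' <-]]; auto.
Qed.

Lemma max_principle_dirichlet (u f : R -> R -> R) a b s T :
  a <= b -> 0 <= s -> s <= T -> jointly_continuous u -> heat_solution u f ->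
  (forall x t, a <= x <= b -> s < t <= T -> f x t <= 0) ->
  (forall x, a <= x <= b -> u x s <= 0) ->
  (forall t, s < t <= T -> u a t <= 0) -> (forall t, s < t <= T -> u b t <= 0) ->
  forall x, a <= x <= b -> u x T <= 0.
Proof.
intros Hab Hs HsT Hu Hheat Hf Hinit Ha Hb x Hx.
apply (@max_principle u f a b s T); auto; try lra.
intros z t Hz Ht Hpos Hmax.
assert (z <> a) by (intros ->; specialize (Ha t Ht); lra).
assert (z <> b) by (intros ->; specialize (Hb t Ht); lra).
apply (locally_interval _ z a b); simpl; try lra.
intros y Hay Hyb; apply Hmax; simpl in *; lra.
Qed.

(** * Evolution of the mean *)

Lemma ex_RInt_everywhere_continuous (g : R -> R) a b :
  (forall x, continuous g x) -> ex_RInt g a b.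
Proof. intros Hg; apply (ex_RInt_continuous g); auto. Qed.

Lemma is_derive_RInt_upper (g : R -> R) a t :
  (forall x, continuous g x) -> is_derive (fun r => RInt g a r) t (g t).
Proof.
intros Hg; apply (is_derive_RInt g (fun r => RInt g a r) a t); [|apply Hg].
exists (mkposreal 1 Rlt_0_1); intros r _.
apply (RInt_correct g), ex_RInt_everywhere_continuous, Hg.
Qed.

(** The integral from PI to x + 2 PI is the translate by 2 PI of the one from - PI to x. *)
Lemma RInt_periodic (f : R -> R) x :
  periodic f -> (forall y, continuous f y) ->
  RInt f x (x + 2 * PI) = RInt f (- PI) PI.
Proof.
intros Hp Hc.
assert (E : RInt f PI (x + 2 * PI) = RInt f (- PI) x).
{ replace PI with (1 * (- PI) + 2 * PI) at 1 by ring.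
  replace (x + 2 * PI) with (1 * x + 2 * PI) by ring.
  rewrite <- (RInt_comp_lin f) by (apply ex_RInt_everywhere_continuous, Hc).
  apply RInt_ext; intros y _; unfold scal; simpl; unfold mult; simpl.
  rewrite <- (Hp y), !Rmult_1_l; reflexivity. }
assert (C := fun a b c => RInt_Chasles f a b c
  (ex_RInt_everywhere_continuous f a b Hc) (ex_RInt_everywhere_continuous f b c Hc)).
rewrite <- (C x PI (x + 2 * PI)), E, <- (C (- PI) x PI).
apply Rplus_comm.
Qed.

Lemma circle_mean_minus_le (f g : R -> R) e :
  (forall x, continuous f x) -> (forall x, continuous g x) ->
  (forall x, Rabs (f x - g x) <= e) ->
  Rabs (circle_mean f - circle_mean g) <= e.
Proof.
intros Hf Hg H; unfold circle_mean.
assert (HP := PI_RGT_0).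
assert (If := ex_RInt_everywhere_continuous f (- PI) PI Hf).
assert (Ig := ex_RInt_everywhere_continuous g (- PI) PI Hg).
rewrite <- Rmult_minus_distr_l.
replace (RInt f (- PI) PI - RInt g (- PI) PI)
  with (RInt (fun x => minus (f x) (g x)) (- PI) PI)
  by (rewrite (RInt_minus f g); auto).
rewrite Rabs_mult, (Rabs_right (/ _))
  by (apply Rle_ge, Rlt_le, Rinv_0_lt_compat; lra).
apply Rmult_le_reg_l with (2 * PI); [lra|].
rewrite <- Rmult_assoc, Rinv_r, Rmult_1_l by lra.
replace (2 * PI) with (PI - - PI) by ring.
apply abs_RInt_le_const; [lra| |intros; apply H].
apply (ex_RInt_minus f g); auto.
Qed.

Lemma circle_mean_const a : circle_mean (fun _ => a) = a.
Proof.
unfold circle_mean; rewrite RInt_const; unfold scal; simpl; unfold mult; simpl.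
field; apply PI_neq0.
Qed.

Lemma circle_mean_ext (f g : R -> R) :
  (forall x, f x = g x) -> circle_mean f = circle_mean g.
Proof. intros H; unfold circle_mean; f_equal; apply RInt_ext; auto. Qed.

Lemma circle_mean_scal a (f : R -> R) :
  (forall x, continuous f x) ->
  circle_mean (fun x => a * f x) = a * circle_mean f.
Proof.
intros Hf; unfold circle_mean.
assert (H := RInt_scal f (- PI) PI a (ex_RInt_everywhere_continuous f _ _ Hf)).
unfold scal in H; simpl in H; unfold mult in H; simpl in H.
rewrite H; ring.
Qed.

Lemma circle_mean_le (f g : R -> R) :
  (forall x, continuous f x) -> (forall x, continuous g x) ->
  (forall x, f x <= g x) -> circle_mean f <= circle_mean g.
Proof.
intros Hf Hg H; unfold circle_mean; assert (HP := PI_RGT_0).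
apply Rmult_le_compat_l; [apply Rlt_le, Rinv_0_lt_compat; lra|].
apply RInt_le; try lra; auto; apply ex_RInt_everywhere_continuous; auto.
Qed.

Lemma circle_mean_continuous (u : R -> R -> R) t :
  jointly_continuous u -> (forall t, periodic (fun x => u x t)) ->
  continuous (fun s => circle_mean (fun x => u x s)) t.
Proof.
intros Hu Hp; apply continuity_pt_filterlim, continuity_pt_locally; intros eps.
assert (He : 0 < eps / 2) by (generalize (cond_pos eps); lra).
destruct (@jointly_continuous_uniform_periodic u (t - 1) (t + 1) _ Hu Hp He)
  as [d [Hd H]].
assert (Hd1 : 0 < Rmin d 1) by (apply Rmin_pos; lra).
exists (mkposreal _ Hd1); intros r Hr; change (Rabs (r - t) < Rmin d 1) in Hr.
assert (L1 := Rmin_l d 1); assert (L2 := Rmin_r d 1).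
apply Rabs_def2 in Hr as Hr'.
apply Rle_lt_trans with (eps / 2); [|lra].
apply circle_mean_minus_le; try (intros; apply jointly_continuous_l, Hu).
intros x; apply Rlt_le, H; try lra; rewrite Rminus_diag, Rabs_R0; lra.
Qed.

(** A Riemann sum for [circle_mean] with n + 1 equispaced nodes, started at x. The factor 1 in
    [1 * x] matches the affine form l + m * x of [heat_solution_isometry]. *)
Definition translate_mean (n : nat) (f : R -> R) (x : R) : R :=
  / INR (S n) * sum_n (fun j => f (INR j * (2 * PI / INR (S n)) + 1 * x)) n.

(** Left-endpoint rule: each of the n + 1 cells contributes an error of at most its width h times
    e. *)
Lemma Riemann_sum_close (f : R -> R) h e x n :
  (forall y, continuous f y) -> 0 <= h ->
  (forall y z, Rabs (z - y) <= h -> Rabs (f z - f y) <= e) ->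
  Rabs (RInt f x (x + INR (S n) * h)
        - h * sum_n (fun j => f (INR j * h + 1 * x)) n) <= INR (S n) * (h * e).
Proof.
intros Hc Hh Hmod.
assert (Hstep : forall y, Rabs (RInt f y (y + h) - h * f y) <= h * e).
{ intros y.
  replace (h * f y) with (RInt (fun _ => f y) y (y + h))
    by (rewrite RInt_const; unfold scal; simpl; unfold mult; simpl; ring).
  assert (If := ex_RInt_everywhere_continuous f y (y + h) Hc).
  assert (Ic := ex_RInt_const (V := R_NormedModule) y (y + h) (f y)).
  replace (RInt f y (y + h) - RInt (fun _ => f y) y (y + h))
    with (RInt (fun z => minus (f z) (f y)) y (y + h))
    by (rewrite (RInt_minus f (fun _ => f y)); auto).
  replace (h * e) with ((y + h - y) * e) by ring.
  apply abs_RInt_le_const; [lra| |].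
  - apply (ex_RInt_minus f (fun _ => f y)); auto.
  - intros z Hz; apply Hmod, Rabs_le; lra. }
induction n as [|n IH].
- rewrite sum_O; simpl INR; rewrite !Rmult_1_l, Rmult_0_l, Rplus_0_l; apply Hstep.
- rewrite sum_Sn, S_INR.
  set (y := INR (S n) * h + 1 * x).
  rewrite <- (RInt_Chasles f x (x + INR (S n) * h))
    by (apply ex_RInt_everywhere_continuous, Hc).
  replace (x + INR (S n) * h) with y in * by (unfold y; ring).
  replace (x + (INR (S n) + 1) * h) with (y + h) by (unfold y; ring).
  specialize (Hstep y).
  unfold plus; simpl plus; simpl in *.
  match goal with |- Rabs (?a + ?b - h * (?s + ?z)) <= _ =>
    replace (a + b - h * (s + z)) with ((a - h * s) + (b - h * z)) by ring end.
  apply Rle_trans with (1 := Rabs_triang _ _).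
  lra.
Qed.

(** Starting the cells at x instead of - PI leaves the integral over a period unchanged, so one
    bound serves every x. *)
Lemma translate_mean_close (f : R -> R) e n :
  periodic f -> (forall y, continuous f y) ->
  (forall y z, Rabs (z - y) <= 2 * PI / INR (S n) -> Rabs (f z - f y) <= e) ->
  forall x, Rabs (circle_mean f - translate_mean n f x) <= e.
Proof.
intros Hp Hc Hmod x.
assert (HP := PI_RGT_0).
assert (HN : 0 < INR (S n)) by (apply lt_0_INR; lia).
set (h := 2 * PI / INR (S n)) in *.
assert (Hh : 0 < h) by (apply Rdiv_lt_0_compat; lra).
assert (E : INR (S n) * h = 2 * PI) by (unfold h; field; lra).
assert (H := @Riemann_sum_close f h e x n Hc (Rlt_le _ _ Hh) Hmod).
rewrite E, RInt_periodic in H; auto.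
unfold circle_mean, translate_mean; fold h.
set (s := sum_n _ n) in *.
replace (/ INR (S n)) with (/ (2 * PI) * h) by (rewrite <- E; field; lra).
rewrite Rmult_assoc, <- Rmult_minus_distr_l, Rabs_mult, (Rabs_right (/ _))
  by (apply Rle_ge, Rlt_le, Rinv_0_lt_compat; lra).
apply Rmult_le_reg_l with (2 * PI); [lra|].
rewrite <- Rmult_assoc, Rinv_r, Rmult_1_l by lra.
rewrite <- E at 1; lra.
Qed.

Lemma translate_mean_uniform (u : R -> R -> R) s T e :
  jointly_continuous u -> (forall t, periodic (fun x => u x t)) -> 0 < e ->
  exists N, forall n, (N <= n)%nat -> forall x t, s <= t <= T ->
    Rabs (circle_mean (fun y => u y t) - translate_mean n (fun y => u y t) x) <= e.
Proof.
intros Hu Hp He.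
assert (HP := PI_RGT_0).
destruct (@jointly_continuous_uniform_periodic u s T e Hu Hp He) as [d [Hd H]].
(* The integer part suffices because there are n + 1 cells, not n. *)
destruct (nfloor_ex (2 * PI / d)) as [N HN].
{ apply Rlt_le, Rdiv_lt_0_compat; lra. }
exists N; intros n Hn x t Ht.
apply translate_mean_close; auto.
- intros y; apply (@jointly_continuous_l u t y Hu).
- assert (Hd' : 2 * PI / INR (S n) < d).
  { apply le_INR in Hn; rewrite S_INR.
    assert (0 <= INR N) by apply pos_INR.
    apply Rmult_lt_reg_r with (INR n + 1); [lra|].
    unfold Rdiv; rewrite Rmult_assoc, Rinv_l, Rmult_1_r by lra.
    replace (2 * PI) with (d * (2 * PI / d)) by (field; lra).
    apply Rmult_lt_compat_l; lra. }
  intros y z Hyz; apply Rlt_le, H; auto; try lra.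
  rewrite Rminus_diag, Rabs_R0; lra.
Qed.

Lemma sum_n_translates (u f : R -> R -> R) h n :
  jointly_continuous u -> (forall t, periodic (fun x => u x t)) ->
  heat_solution u f ->
  let v := fun x t => sum_n (fun j => u (INR j * h + 1 * x) t) n in
  let g := fun x t => sum_n (fun j => f (INR j * h + 1 * x) t) n in
  jointly_continuous v /\ (forall t, periodic (fun x => v x t)) /\
  heat_solution v g.
Proof.
intros Hu Hp Hheat.
assert (Hone : forall j,
  jointly_continuous (fun x t => u (INR j * h + 1 * x) t) /\
  (forall t, periodic (fun x => u (INR j * h + 1 * x) t)) /\
  heat_solution (fun x t => u (INR j * h + 1 * x) t)
                (fun x t => f (INR j * h + 1 * x) t)).
{ intros j; split; [|split].
  - intros x t.
    apply (@jointly_continuous_comp u (fun p => INR j * h + 1 * fst p) snd); auto.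
    + apply (continuous_plus (fun _ => INR j * h) (fun p : R * R => 1 * fst p));
        [apply continuous_const|].
      apply (continuous_scal_r 1 (fun p : R * R => fst p)), continuous_fst.
    + apply continuous_snd.
  - intros t x; rewrite <- (Hp t (INR j * h + 1 * x)); f_equal; ring.
  - apply heat_solution_isometry; auto; ring. }
induction n as [|n [IH1 [IH2 IH3]]]; intros v g.
- destruct (Hone 0%nat) as [H1 [H2 H3]].
  assert (Ev : forall x t, u (INR 0 * h + 1 * x) t = v x t)
    by (intros; unfold v; rewrite sum_O; reflexivity).
  split; [|split].
  + intros x t; apply (continuous_ext (fun p : R * R => u (INR 0 * h + 1 * fst p) (snd p)));
      [intros; apply Ev | apply H1].
  + intros t x; rewrite <- !Ev; apply H2.
  + apply heat_solution_ext with (3 := H3); auto.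
    intros; unfold g; rewrite sum_O; reflexivity.
- destruct (Hone (S n)) as [H1 [H2 H3]].
  split; [|split].
  + intros x t; unfold v.
    apply (continuous_ext (fun p : R * R =>
      plus (sum_n (fun j => u (INR j * h + 1 * fst p) (snd p)) n)
           (u (INR (S n) * h + 1 * fst p) (snd p)))).
    * intros p; symmetry.
      apply (sum_Sn (fun j => u (INR j * h + 1 * fst p) (snd p))).
    * apply (continuous_plus (fun p : R * R =>
        sum_n (fun j => u (INR j * h + 1 * fst p) (snd p)) n));
        [apply IH1 | apply H1].
  + intros t x; unfold v; rewrite !sum_Sn; f_equal; [apply IH2 | apply H2].
  + apply heat_solution_ext with (3 := heat_solution_lin 1 1 _ _ _ _ IH3 H3);
      intros x t; unfold v, g; rewrite sum_Sn; unfold plus; simpl; ring.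
Qed.

(* Averages of finitely many translates solve the same equation and converge
   to the mean, so the maximum principle replaces differentiation under the
   integral, for which no local bound on the time derivative is available. *)
Lemma circle_mean_heat_le (u f : R -> R -> R) T :
  0 <= T -> jointly_continuous u -> jointly_continuous f ->
  (forall t, periodic (fun x => u x t)) -> (forall t, periodic (fun x => f x t)) ->
  heat_solution u f ->
  circle_mean (fun x => u x T) <=
  circle_mean (fun x => u x 0) + RInt (fun t => circle_mean (fun x => f x t)) 0 T.
Proof.
intros HT Hu Hf Pu Pf Hheat.
set (m := fun t => circle_mean (fun x => f x t)).
assert (Hm : forall t, continuous m t)
  by (intros; apply circle_mean_continuous; auto).
apply le_epsilon; intros eps Heps.
(* Budget: e for approximating the mean of u at time 0, e at time T, and e * T for the mean of the
   source. *)
set (e := eps / (T + 2)).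
assert (He : 0 < e) by (apply Rdiv_lt_0_compat; lra).
assert (Ee : e * T = eps - 2 * e) by (unfold e; field; lra).
destruct (@translate_mean_uniform u 0 T e Hu Pu He) as [N1 H1].
destruct (@translate_mean_uniform f 0 T e Hf Pf He) as [N2 H2].
set (n := max N1 N2).
destruct (@sum_n_translates u f (2 * PI / INR (S n)) n Hu Pu Hheat)
  as [C1 [C2 C3]].
set (v := fun x t => sum_n (fun j => u (INR j * (2 * PI / INR (S n)) + 1 * x) t) n) in *.
set (g := fun x t => sum_n (fun j => f (INR j * (2 * PI / INR (S n)) + 1 * x) t) n) in *.
assert (Ku : forall x t, 0 <= t <= T ->
  Rabs (circle_mean (fun y => u y t) - / INR (S n) * v x t) <= e)
  by exact (H1 n (Nat.le_max_l _ _)).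
assert (Kf : forall x t, 0 <= t <= T -> Rabs (m t - / INR (S n) * g x t) <= e)
  by exact (H2 n (Nat.le_max_r _ _)).
set (a := circle_mean (fun x => u x 0)) in *.
(* A supersolution constant in space: its initial value and its slope each exceed the true mean by
   e, the error made by the finite averages. *)
set (b := fun t => a + e + RInt m 0 t + e * t).
assert (Db : forall t, is_derive b t (m t + e)).
{ intros t; unfold b.
  apply (is_derive_plus (fun t => a + e + RInt m 0 t) (fun t => e * t)).
  - rewrite <- (Rplus_0_l (m t)).
    apply (is_derive_plus (fun _ => a + e) (fun t => RInt m 0 t)).
    + apply (is_derive_const (a + e)).
    + apply is_derive_RInt_upper, Hm.
  - auto_derive; auto; ring. }
assert (Hneg : forall x, / INR (S n) * v x T + -1 * b T <= 0).
{ apply (@max_principle_periodic (fun x t => / INR (S n) * v x t + -1 * b t)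
    (fun x t => / INR (S n) * g x t + -1 * (m t + e)) 0 T); auto; try lra.
  - intros x t.
    apply (continuous_plus (fun p : R * R => / INR (S n) * v (fst p) (snd p))
                           (fun p => -1 * b (snd p))).
    + apply (continuous_scal_r (/ INR (S n)) (fun p : R * R => v (fst p) (snd p))), C1.
    + apply (continuous_scal_r (-1) (fun p : R * R => b (snd p))).
      apply (continuous_comp snd b); [apply continuous_snd|].
      apply (ex_derive_continuous b); eexists; apply Db.
  - apply heat_solution_lin; auto.
    apply (@heat_solution_time b); auto.
  - intros t x; exact (f_equal (fun r => / INR (S n) * r + -1 * b t) (C2 t x)).
  - intros x t Ht; assert (H := Kf x t).
    apply Rabs_le_between in H; lra.
  - intros x; unfold b; assert (Z : RInt m 0 0 = 0) by exact (RInt_point 0 m).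
    assert (H := Ku x 0); apply Rabs_le_between in H; fold a in H; lra. }
specialize (Hneg 0); assert (H := Ku 0 T).
apply Rabs_le_between in H; unfold b in Hneg; lra.
Qed.

(** The reverse inequality is the one-sided bound applied to -u with source -f. *)
Lemma circle_mean_heat (u f : R -> R -> R) T :
  0 <= T -> jointly_continuous u -> jointly_continuous f ->
  (forall t, periodic (fun x => u x t)) -> (forall t, periodic (fun x => f x t)) ->
  heat_solution u f ->
  circle_mean (fun x => u x T) =
  circle_mean (fun x => u x 0) + RInt (fun t => circle_mean (fun x => f x t)) 0 T.
Proof.
intros HT Hu Hf Pu Pf Hheat; apply Rle_antisym.
{ apply circle_mean_heat_le; auto. }
assert (Copp : forall w, jointly_continuous w ->
  jointly_continuous (fun x t => -1 * w x t)).
{ intros w Hw x t; apply (continuous_scal_r (-1) (fun p : R * R => w (fst p) (snd p))), Hw. }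
assert (Popp : forall w : R -> R -> R, (forall t, periodic (fun x => w x t)) ->
  forall t, periodic (fun x => -1 * w x t)).
{ intros w Hw t x; simpl; rewrite <- (Hw t x); reflexivity. }
assert (H : heat_solution (fun x t => -1 * u x t) (fun x t => -1 * f x t)).
{ apply heat_solution_ext with (3 := heat_solution_lin (-1) 0 _ _ _ _ Hheat Hheat);
    intros; ring. }
assert (M : forall w t, jointly_continuous w ->
  circle_mean (fun x => -1 * w x t) = - circle_mean (fun x => w x t)).
{ intros w t Hw; rewrite circle_mean_scal; [ring|].
  intros x; apply jointly_continuous_l, Hw. }
apply circle_mean_heat_le with (T := T) in H; auto.
rewrite !M in H by auto.
rewrite (RInt_ext _ (fun t => opp (circle_mean (fun x => f x t)))) in H
  by (intros; rewrite M; auto).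
rewrite (RInt_opp (fun t => circle_mean (fun x => f x t))) in H.
- unfold opp in H; simpl in H; lra.
- apply ex_RInt_everywhere_continuous; intros; apply circle_mean_continuous; auto.
Qed.

(** * Decay of the oscillation *)

Lemma heat_solution_cos_mode s phi :
  heat_solution (fun x t => exp (- (4 / 9) * (t - s)) * cos (2 / 3 * x + phi))
                (fun _ _ => 0).
Proof.
intros x t _.
set (E := exp (- (4 / 9) * (t - s))).
exists (fun y => - (2 / 3) * E * sin (2 / 3 * y + phi)),
  (- (4 / 9) * E * cos (2 / 3 * x + phi)); split; [|split].
- intros y; auto_derive; auto; ring.
- auto_derive; auto; field.
- auto_derive; auto; fold (t - s) E; ring.
Qed.

Lemma cos_ge_half x : Rabs x <= PI / 3 -> 1 / 2 <= cos x.
Proof.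
intros Hx; assert (HP := PI_RGT_0); assert (H0 := Rabs_pos x).
rewrite <- cos_PI3.
assert (E : cos x = cos (Rabs x)).
{ unfold Rabs; destruct (Rcase_abs x); [rewrite cos_neg|]; reflexivity. }
rewrite E; apply cos_decr_1; lra.
Qed.

(* Reflecting about the midpoint p of x and y gives a solution vanishing at p
   and p + PI.  It is dominated by a slowly decaying mode that stays above 1/2
   on [p, p + PI], hence needs no smoothness of the data at time s. *)
Lemma oscillation_decay (u f : R -> R -> R) (m : R -> R) s T O :
  0 <= s -> s <= T -> jointly_continuous u ->
  (forall t, periodic (fun x => u x t)) -> heat_solution u f ->
  (forall t, continuous m t) -> (forall t, s <= t -> 0 <= m t) ->
  (forall x y t, s < t <= T -> f x t - f y t <= m t) ->
  (forall x y, u x s - u y s <= O) ->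
  forall x y, u x T - u y T <= 2 * O * exp (- (4 / 9) * (T - s)) + RInt m s T.
Proof.
intros Hs HsT Hu Hp Hheat Hm Hm0 Hf HO x y.
assert (HP := PI_RGT_0).
assert (O_pos : 0 <= O) by (specialize (HO 0 0); lra).
(* By periodicity y may be taken in [x - 2 PI, x], which is exactly what puts x in [p, p + PI] for
   the midpoint p. *)
cut (forall y', x - 2 * PI <= y' <= x ->
  u x T - u y' T <= 2 * O * exp (- (4 / 9) * (T - s)) + RInt m s T).
{ intros Hgen.
  assert (Pg : periodic (fun z => u (x - 2 * PI + z) T)).
  { intros z; rewrite <- (Hp T (x - 2 * PI + z)); f_equal; ring. }
  destruct (periodic_reduce (y - (x - 2 * PI)) Pg) as [z [Hz E]].
  replace (x - 2 * PI + (y - (x - 2 * PI))) with y in E by ring.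
  rewrite <- E; apply Hgen; lra. }
clear y; intros y Hxy.
set (p := (x + y) / 2).
(* This phase centres the cosine at p + PI / 2. *)
set (phi := - (2 / 3) * p - PI / 3).
set (B := fun x t => exp (- (4 / 9) * (t - s)) * cos (2 / 3 * x + phi)).
set (I := fun t => RInt m s t).
assert (DI : forall t, is_derive I t (m t))
  by (intros; apply is_derive_RInt_upper, Hm).
assert (I_pos : forall t, s <= t -> 0 <= I t).
{ intros t Ht; apply RInt_ge_0; auto.
  - apply ex_RInt_everywhere_continuous, Hm.
  - intros r Hr; apply Hm0; lra. }
assert (I_s : I s = 0) by exact (RInt_point s m).
(* Since [B] >= 1/2 at time s, the factor 2 * O lifts the barrier to at least O there. The
   coefficients 1 reproduce the form given by [heat_solution_lin]. *)
set (z := fun x t => 1 * (1 * (1 * u x t + -1 * u (2 * p + -1 * x) t)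
                          + (-2 * O) * B x t) + -1 * I t).
assert (Hz : heat_solution z (fun x t =>
  1 * (1 * (1 * f x t + -1 * f (2 * p + -1 * x) t) + (-2 * O) * 0) + -1 * m t)).
{ apply heat_solution_lin; [|apply (heat_solution_time I); auto].
  apply heat_solution_lin; [|apply heat_solution_cos_mode].
  apply heat_solution_lin; [exact Hheat|].
  apply heat_solution_isometry; auto; ring. }
assert (Cz : jointly_continuous z).
{ intros a t; unfold z.
  assert (Cc : forall r (g : R * R -> R), continuous g (a, t) ->
    continuous (fun q => r * g q) (a, t))
    by (intros r g Hg; apply (continuous_scal_r r g), Hg).
  assert (C1 : forall v : R -> R, (forall b, ex_derive v b) ->
    continuous (fun q : R * R => v (fst q)) (a, t)).
  { intros v Hv; apply (continuous_comp fst v); [apply continuous_fst|].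
    apply (ex_derive_continuous v), Hv. }
  assert (C2 : forall v : R -> R, (forall b, ex_derive v b) ->
    continuous (fun q : R * R => v (snd q)) (a, t)).
  { intros v Hv; apply (continuous_comp snd v); [apply continuous_snd|].
    apply (ex_derive_continuous v), Hv. }
  apply (continuous_plus (fun q : R * R => 1 * (1 * (1 * u (fst q) (snd q)
    + -1 * u (2 * p + -1 * fst q) (snd q)) + (-2 * O) * B (fst q) (snd q)))
    (fun q => -1 * I (snd q))).
  - apply Cc.
    apply (continuous_plus (fun q : R * R => 1 * (1 * u (fst q) (snd q)
      + -1 * u (2 * p + -1 * fst q) (snd q)))
      (fun q => (-2 * O) * B (fst q) (snd q))); apply Cc.
    + apply (continuous_plus (fun q : R * R => 1 * u (fst q) (snd q))
        (fun q => -1 * u (2 * p + -1 * fst q) (snd q))); apply Cc.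
      * apply Hu.
      * apply (jointly_continuous_comp u (fun q => 2 * p + -1 * fst q) snd); auto.
        -- apply (C1 (fun b => 2 * p + -1 * b)); intros b; auto_derive; auto.
        -- apply continuous_snd.
    + apply (continuous_mult (fun q : R * R => exp (- (4 / 9) * (snd q - s)))
        (fun q => cos (2 / 3 * fst q + phi))).
      * apply (C2 (fun b => exp (- (4 / 9) * (b - s)))); intros b; auto_derive; auto.
      * apply (C1 (fun b => cos (2 / 3 * b + phi))); intros b; auto_derive; auto.
  - apply Cc, (C2 I); intros b; eexists; apply DI. }
assert (B_pos : forall a t, p <= a <= p + PI ->
  / 2 * exp (- (4 / 9) * (t - s)) <= B a t).
{ intros a t Ha; unfold B.
  assert (Hc : 1 / 2 <= cos (2 / 3 * a + phi))
    by (apply cos_ge_half, Rabs_le; unfold phi; lra).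
  assert (He := exp_pos (- (4 / 9) * (t - s))); nra. }
assert (Bd : forall a t, p <= a <= p + PI -> 0 <= O * B a t).
{ intros a t Ha; apply Rmult_le_pos; auto.
  assert (He := exp_pos (- (4 / 9) * (t - s))); specialize (B_pos a t Ha); lra. }
assert (Hneg : z x T <= 0).
{ apply max_principle_dirichlet with (2 := Hs) (5 := Hz) (a := p) (b := p + PI);
    auto; try lra; unfold z.
  - intros a t Ha Ht; specialize (Hf a (2 * p + -1 * a) t Ht); lra.
  - intros a Ha; rewrite I_s; specialize (HO a (2 * p + -1 * a)).
    specialize (B_pos a s Ha).
    rewrite Rminus_diag, Rmult_0_r, exp_0 in B_pos; nra.
  - intros t Ht; replace (2 * p + -1 * p) with p by ring.
    specialize (I_pos t); specialize (Bd p t); lra.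
  (* The reflection sends p + PI to p - PI, the same point of the circle. *)
  - intros t Ht; assert (E := Hp t (2 * p + -1 * (p + PI))); simpl in E.
    replace (2 * p + -1 * (p + PI) + 2 * PI) with (p + PI) in E by ring.
    specialize (I_pos t); specialize (Bd (p + PI) t); lra.
  - unfold p; lra. }
unfold z in Hneg.
replace (2 * p + -1 * x) with y in Hneg by (unfold p; field).
assert (HB : B x T <= exp (- (4 / 9) * (T - s))).
{ unfold B; assert (He := exp_pos (- (4 / 9) * (T - s))).
  assert (Hc := COS_bound (2 / 3 * x + phi)); nra. }
apply Rmult_le_compat_l with (1 := O_pos) in HB; lra.
Qed.

(** * Spatial maxima as functions of time, and convergence of integrals *)

Lemma continuous_on_comp_total (U V W : UniformSpace) (P : V -> Prop)
    (g : V -> W) (h : U -> V) x :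
  continuous_on P g -> (forall y, P (h y)) -> continuous h x ->
  continuous (fun y => g (h y)) x.
Proof.
intros Hg HP Hh Q HQ.
assert (H := Hh _ (Hg (h x) (HP x) Q HQ)).
(* The filter [within P] adds only the premise [P (h y)], which always holds. *)
unfold filtermap in *; revert H; apply filter_imp; auto.
Qed.

Lemma circle_max_continuous (u : R -> R -> R) t :
  jointly_continuous u -> (forall t, periodic (fun x => u x t)) ->
  continuous (fun s => circle_max (fun x => u x s)) t.
Proof.
intros Hu Hp.
apply continuity_pt_filterlim, continuity_pt_locally; intros eps.
destruct (jointly_continuous_uniform_periodic u (t - 1) (t + 1) eps Hu Hp
  (cond_pos eps)) as [d [Hd H]].
assert (Hd1 : 0 < Rmin d 1) by (apply Rmin_pos; lra).
exists (mkposreal _ Hd1); intros r Hr; change (Rabs (r - t) < Rmin d 1) in Hr.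
assert (L1 := Rmin_l d 1); assert (L2 := Rmin_r d 1).
apply Rabs_def2 in Hr as Hr'.
destruct (circle_max_spec (Hp t)) as [[x Ex] Bt];
  [intros; apply (jointly_continuous_l u), Hu|].
destruct (circle_max_spec (Hp r)) as [[y Ey] Br];
  [intros; apply (jointly_continuous_l u), Hu|].
rewrite <- Ex, <- Ey; rewrite <- Ex in Bt; rewrite <- Ey in Br.
assert (E : forall a, Rabs (u a r - u a t) < eps)
  by (intros a; apply H; try lra; rewrite Rminus_diag, Rabs_R0; lra).
assert (E1 := E x); assert (E2 := E y).
apply Rabs_def2 in E1; apply Rabs_def2 in E2.
specialize (Bt y); specialize (Br x); simpl in *.
apply Rabs_def1; lra.
Qed.

Lemma circle_mean_le_max (f : R -> R) :
  periodic f -> (forall x, continuous f x) -> circle_mean f <= circle_max f.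
Proof.
intros Hp Hc; rewrite <- (circle_mean_const (circle_max f)).
apply circle_mean_le; auto.
- intros; apply continuous_const.
- apply (circle_max_spec Hp Hc).
Qed.

(** The integral is nondecreasing in t and l is its supremum. Having both bounds also controls
    tails: the integral over [T, t] is below e. *)
Lemma bounded_integral_limit (g : R -> R) K :
  (forall t, continuous g t) -> (forall t, 0 <= t -> 0 <= g t) ->
  (forall t, 0 <= t -> RInt g 0 t <= K) ->
  exists l, forall e, 0 < e -> exists T, 0 <= T /\
    forall t, T <= t -> l - e < RInt g 0 t <= l.
Proof.
intros Hc Hg HK.
destruct (completeness (fun r => exists t, 0 <= t /\ r = RInt g 0 t)) as [l [Hl1 Hl2]].
- exists K; intros r [t [Ht ->]]; auto.
- exists (RInt g 0 0), 0; split; [lra|reflexivity].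
- exists l; intros e He.
  destruct (classic (exists T, 0 <= T /\ l - e < RInt g 0 T)) as [[T [HT HTe]]|Hn].
  + exists T; split; auto; intros t Ht; split; [|apply Hl1; exists t; split; lra].
    assert (C := RInt_Chasles g 0 T t (ex_RInt_everywhere_continuous g _ _ Hc)
      (ex_RInt_everywhere_continuous g _ _ Hc)).
    unfold plus in C; simpl in C.
    assert (0 <= RInt g T t); [|lra].
    apply RInt_ge_0; auto; [apply ex_RInt_everywhere_continuous, Hc|].
    intros r Hr; apply Hg; lra.
  + exfalso; assert (l <= l - e); [|lra].
    apply Hl2; intros r [t [Ht ->]].
    destruct (Rle_lt_dec (RInt g 0 t) (l - e)); auto.
    exfalso; apply Hn; exists t; auto.
Qed.

Lemma exp_decay O b e :
  0 <= O -> 0 < b -> 0 < e -> exists T, 0 <= T /\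
    forall r, T <= r -> 2 * O * exp (- b * r) <= e.
Proof.
(* At this time b * T = 2 * O / e, and exp y >= 1 + y concludes. *)
intros HO Hb He; exists (2 * O / e / b).
assert (H0 : 0 <= 2 * O / e) by (apply Rdiv_le_0_compat; lra).
split; [apply Rdiv_le_0_compat; lra|].
intros r Hr.
assert (Hbr : 2 * O / e <= b * r).
{ replace (2 * O / e) with (b * (2 * O / e / b)) by (field; lra).
  apply Rmult_le_compat_l; lra. }
assert (H1 : 2 * O <= e * exp (b * r)).
{ assert (Hx := exp_ineq1_le (b * r)).
  replace (2 * O) with (e * (2 * O / e)) by (field; lra).
  apply Rmult_le_compat_l; lra. }
replace (- b * r) with (- (b * r)) by ring; rewrite exp_Ropp.
assert (Hp := exp_pos (b * r)).
apply Rmult_le_reg_r with (exp (b * r)); [exact Hp|].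
rewrite Rmult_assoc, Rinv_l by lra; lra.
Qed.

(** * The discounted solution *)

(** Nothing is known of [h] for t <= 0, but an integral over [0, b] sees only the open interval, so
    the continuous [g] can stand in for it. *)
Lemma RInt_gen_limit (g h : R -> R) l :
  (forall t, continuous g t) -> (forall t, 0 < t -> h t = g t) ->
  (forall e, 0 < e -> exists T, 0 <= T /\
     forall t, T <= t -> Rabs (RInt g 0 t - l) < e) ->
  is_RInt_gen h (at_point 0) (Rbar_locally p_infty) l.
Proof.
intros Hc Hhg Hl P [e HP].
destruct (Hl e (cond_pos e)) as [T [HT H]].
apply (Filter_prod _ _ _ (fun a => a = 0) (fun b => T < b)).
- reflexivity.
- exists T; auto.
- intros a b -> Hb; exists (RInt g 0 b); split.
  + apply (is_RInt_ext g).
    * intros r Hr; simpl in Hr; rewrite Rmin_left in Hr by lra.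
      symmetry; apply Hhg; lra.
    * apply (RInt_correct g), ex_RInt_everywhere_continuous, Hc.
  + apply HP, H; lra.
Qed.

(* Functions of t >= 0 are precomposed with |t| to make them continuous on R. *)
Lemma continuous_circle_time_Rabs (u : R -> R -> R) :
  continuous_circle_time u -> jointly_continuous (fun x t => u x (Rabs t)).
Proof.
intros Hu x t.
apply (continuous_on_comp_total _ _ _ (fun p : R * R => nonneg_time (snd p))
  (fun p => u (fst p) (snd p)) (fun p : R * R => (fst p, Rabs (snd p)))); auto.
- intros p; apply Rabs_pos.
- apply (continuous_comp_2 fst (fun p : R * R => Rabs (snd p)) (fun a b => (a, b))).
  + apply continuous_fst.
  + apply (continuous_comp snd Rabs); [apply continuous_snd | apply continuous_Rabs].
  + apply (continuous_ext (fun p : R * R => p)); [intros []; reflexivity|].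
    apply continuous_id.
Qed.

Lemma discount_Rabs (A : R -> R) t :
  0 <= t -> discount (fun s => A (Rabs s)) t = discount A t.
Proof.
intros Ht; unfold discount; do 2 f_equal; apply RInt_ext.
intros s Hs; rewrite Rmin_left in Hs by lra; rewrite Rabs_right; [reflexivity|lra].
Qed.

Lemma is_derive_discount (A : R -> R) t :
  (forall s, continuous A s) ->
  is_derive (discount A) t (- A t * discount A t).
Proof.
intros HA; unfold discount.
apply (is_derive_comp exp (fun t => - RInt A 0 t)); [apply is_derive_exp|].
apply (is_derive_opp (fun t => RInt A 0 t)), is_derive_RInt_upper, HA.
Qed.

(** The term A k cancels against D' = - A D, leaving the source - D c. *)
Lemma discounted_heat_solution A c k0 k :
  (forall s, continuous (fun t => A (Rabs t)) s) -> classical_solution A c k0 k ->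
  let D := discount (fun t => A (Rabs t)) in
  heat_solution (fun x t => D t * k x (Rabs t))
                (fun x t => D t * (-1 * c x (Rabs t))).
Proof.
intros HA Hk D x t Ht.
assert (Et : Rabs t = t) by (apply Rabs_right; lra).
exists (fun y => D t * Derive (fun z => k z t) y),
  (D t * Derive_n (fun z => k z t) 2 x).
rewrite Et; split; [|split].
- intros y; apply is_derive_scal, Derive_correct, (sol_diff_x Hk); auto.
- apply is_derive_scal, Derive_correct, (sol_diff_xx Hk); auto.
- apply (is_derive_ext_loc (fun s => D s * k x s)).
  + exists (mkposreal t Ht); intros s Hs; change (Rabs (s - t) < t) in Hs.
    apply Rabs_def2 in Hs; rewrite (Rabs_right s); [reflexivity|lra].
  + replace (D t * Derive_n (fun z => k z t) 2 x + D t * (-1 * c x t))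
      with (- A (Rabs t) * D t * k x t + D t * Derive (fun s => k x s) t)
      by (rewrite (sol_pde Hk), Et by auto; ring).
    apply (is_derive_mult D (fun s => k x s)).
    * apply is_derive_discount, HA.
    * apply Derive_correct, (sol_diff_t Hk); auto.
    * intros a b; apply Rmult_comm.
Qed.

Lemma heat_convergence (u f : R -> R -> R) (m : R -> R) K L :
  jointly_continuous u -> jointly_continuous f ->
  (forall t, periodic (fun x => u x t)) -> (forall t, periodic (fun x => f x t)) ->
  heat_solution u f ->
  (forall t, continuous m t) -> (forall x t, 0 <= t -> - m t <= f x t <= 0) ->
  (forall t, 0 <= t -> RInt m 0 t <= K) ->
  (forall e, 0 < e -> exists T, 0 <= T /\ forall t, T <= t ->
     Rabs (RInt (fun s => circle_mean (fun x => f x s)) 0 t - L) < e) ->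
  uniform_limit_at_infinity u (circle_mean (fun x => u x 0) + L).
Proof.
intros Hu Hf Pu Pf Hheat Hm Hfm HK HL eps Heps.
assert (Hm0 : forall t, 0 <= t -> 0 <= m t)
  by (intros t Ht; specialize (Hfm 0 t Ht); lra).
destruct (bounded_integral_limit m K Hm Hm0 HK) as [lm Hlm].
(* One third each for the decayed oscillation, the tail of m, and the convergence of the mean. *)
set (e := eps / 3); assert (He : 0 < e) by (unfold e; lra).
destruct (Hlm e He) as [T1 [HT1 H1]].
destruct (HL e He) as [T2 [HT2 H2]].
assert (Hosc : exists O, 0 <= O /\ forall x y, u x T1 - u y T1 <= O).
{ destruct (rectangle_max u 0 (2 * PI) T1 T1) as [a [t [_ [Ht Hmax]]]]; auto;
    try (generalize PI_RGT_0; lra).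
  destruct (rectangle_max (fun x t => u (0 + x) t * -1) 0 (2 * PI) T1 T1)
    as [b [r [_ [Hr Hmin]]]]; try (generalize PI_RGT_0; lra).
  { intros x r; apply (continuous_mult (fun p : R * R => u (0 + fst p) (snd p))
      (fun _ => -1)); [|apply continuous_const].
    apply (jointly_continuous_comp u (fun p => 0 + fst p) snd); auto.
    - apply (continuous_plus (fun _ => 0) fst);
        [apply continuous_const | apply continuous_fst].
    - apply continuous_snd. }
  assert (Hall : forall x y, u x T1 - u y T1 <= u a t - u (0 + b) r).
  { intros x y.
    destruct (periodic_reduce x (Pu T1)) as [x' [Hx' <-]].
    destruct (periodic_reduce y (Pu T1)) as [y' [Hy' <-]].
    assert (E1 := Hmax x' T1 Hx'); assert (E2 := Hmin y' T1 Hy').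
    rewrite Rplus_0_l in E2; lra. }
  exists (u a t - u (0 + b) r); split; auto.
  specialize (Hall 0 0); lra. }
destruct Hosc as [O [HO Hosc]].
destruct (exp_decay O (4 / 9) e) as [T3 [HT3 H3]]; try lra.
set (T := Rmax (T1 + T3) T2).
assert (L1 := Rmax_l (T1 + T3) T2 : T1 + T3 <= T).
assert (L2 := Rmax_r (T1 + T3) T2 : T2 <= T).
exists T; split; [lra|]; intros t Ht x.
assert (Hd : forall a b, u a t - u b t <= 2 * e).
{ intros a b.
  assert (Hdec := oscillation_decay u f m T1 t O).
  apply Rle_trans with (2 * O * exp (- (4 / 9) * (t - T1)) + RInt m T1 t).
  - apply Hdec; auto; try lra; [intros; apply Hm0; lra|].
    (* Both values of f lie in [- m, 0], so they differ by at most m, not 2 m. *)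
    intros x' y' s Hs; assert (0 <= s) by lra.
    assert (A1 := Hfm x' s); assert (A2 := Hfm y' s); lra.
  - assert (C := RInt_Chasles m 0 T1 t (ex_RInt_everywhere_continuous m _ _ Hm)
      (ex_RInt_everywhere_continuous m _ _ Hm)).
    unfold plus in C; simpl in C.
    assert (E1 := H1 T1 (Rle_refl _)); assert (E2 := H1 t).
    assert (E3 := H3 (t - T1)); lra. }
(* Averaging u x t - u y t over y turns the oscillation bound into a distance to the mean. *)
assert (Hmean : Rabs (u x t - circle_mean (fun y => u y t)) <= 2 * e).
{ rewrite <- (circle_mean_const (u x t)) at 1.
  apply circle_mean_minus_le.
  - intros; apply continuous_const.
  - intros; apply jointly_continuous_l, Hu.
  - intros y; apply Rabs_le; assert (E1 := Hd x y); assert (E2 := Hd y x); lra. }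
assert (Ht0 : 0 <= t) by lra.
rewrite (circle_mean_heat u f t Ht0) in Hmean; auto.
specialize (H2 t); apply Rabs_def2 in H2; [|lra].
apply Rabs_le_between in Hmean; apply Rabs_def1; unfold e in *; lra.
Qed.

Theorem proposition7
  (k0 : R -> R) (c : R -> R -> R) (A : R -> R) (k : R -> R -> R)
  (k0_periodic : periodic k0)
  (k0_continuous : forall x, continuous k0 x)
  (k0_nonneg : forall x, 0 <= k0 x)
  (c_periodic : forall t, 0 <= t -> periodic (fun x => c x t))
  (c_continuous : continuous_circle_time c)
  (c_nonneg : forall x t, 0 <= t -> 0 <= c x t)
  (A_continuous : continuous_on nonneg_time A)
  (A_nonneg : forall t, 0 <= t -> 0 <= A t)
  (A_lower : exists Aplus, 0 < Aplus /\ forall t, 0 <= t -> Aplus <= A t)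
  (k0_large : forall x t, 0 <= t ->
     k0 x >= RInt (fun s => discount A s * circle_max (fun y => c y s)) 0 t)
  (k_solution : classical_solution A c k0 k)
  (k_nonneg : forall x t, 0 <= t -> 0 <= k x t)
  (c_mean_bounded : exists M, forall t, 0 <= t ->
     Rabs (circle_mean (fun x => c x t)) <= M) :
  ex_RInt_gen (fun s => discount A s * circle_mean (fun x => c x s))
    (at_point 0) (Rbar_locally p_infty) /\
  uniform_limit_at_infinity (fun x t => k x t * discount A t)
    (circle_mean k0
     - RInt_gen (fun s => discount A s * circle_mean (fun x => c x s))
         (at_point 0) (Rbar_locally p_infty)).
Proof.
set (D := discount (fun t => A (Rabs t))).
set (ca := fun x t => c x (Rabs t)).
(* As c >= 0, this is the sup norm of the source - D c, whose mean is - [g]. *)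
set (m := fun t => D t * circle_max (fun x => ca x t)).
set (g := fun t => D t * circle_mean (fun x => ca x t)).
assert (CA : forall t, continuous (fun s => A (Rabs s)) t).
{ intros t; apply (continuous_on_comp_total _ _ _ nonneg_time A Rabs); auto.
  - intros; apply Rabs_pos.
  - apply continuous_Rabs. }
assert (CD : forall t, continuous D t)
  by (intros t; apply (ex_derive_continuous D); eexists; apply is_derive_discount, CA).
assert (D_pos : forall t, 0 < D t) by (intros; apply exp_pos).
assert (Cc : jointly_continuous ca) by (apply continuous_circle_time_Rabs; auto).
assert (Pc : forall t, periodic (fun x => ca x t))
  by (intros t; apply c_periodic, Rabs_pos).
assert (CcX : forall t x, continuous (fun y => ca y t) x)
  by (intros; apply jointly_continuous_l, Cc).
assert (Cmax : forall t, continuous m t).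
{ intros t; apply (continuous_mult D (fun s => circle_max (fun x => ca x s)));
    [|apply circle_max_continuous]; auto. }
assert (Cg : forall t, continuous g t).
{ intros t; apply (continuous_mult D (fun s => circle_mean (fun x => ca x s)));
    [|apply circle_mean_continuous]; auto. }
assert (ca_pos : forall x t, 0 <= ca x t)
  by (intros; apply c_nonneg, Rabs_pos).
assert (g_pos : forall t, 0 <= g t).
{ intros t; apply Rmult_le_pos; [apply Rlt_le, D_pos|].
  rewrite <- (circle_mean_const 0); apply circle_mean_le; auto.
  intros; apply continuous_const. }
(* [k0_large] at the single point 0 bounds all partial integrals of m at once. *)
assert (m_bound : forall t, 0 <= t -> RInt m 0 t <= k0 0).
{ intros t Ht; apply Rge_le; specialize (k0_large 0 t Ht).
  erewrite RInt_ext; [exact k0_large|].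
  intros s Hs; rewrite Rmin_left in Hs by lra.
  unfold m, D, ca; rewrite discount_Rabs, (Rabs_right s) by lra; reflexivity. }
assert (g_bound : forall t, 0 <= t -> RInt g 0 t <= k0 0).
{ intros t Ht; apply Rle_trans with (2 := m_bound t Ht).
  apply RInt_le; auto; try (apply ex_RInt_everywhere_continuous; auto).
  intros s _; apply Rmult_le_compat_l; [apply Rlt_le, D_pos|].
  apply circle_mean_le_max; auto. }
(* Since 0 <= g <= m, the improper integral converges by monotonicity. *)
destruct (bounded_integral_limit g (k0 0)) as [l Hl]; auto.
assert (Hgen : is_RInt_gen (fun s => discount A s * circle_mean (fun x => c x s))
  (at_point 0) (Rbar_locally p_infty) l).
{ apply RInt_gen_limit with g; auto.
  - intros t Ht; unfold g, D, ca; rewrite discount_Rabs, (Rabs_right t) by lra.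
    reflexivity.
  - intros e He; destruct (Hl e He) as [T [HT H]]; exists T; split; auto.
    intros t Ht; specialize (H t Ht); apply Rabs_def1; lra. }
split; [exists l; exact Hgen|].
rewrite (is_RInt_gen_unique _ _ Hgen).
assert (CDp : forall v, jointly_continuous v -> jointly_continuous (fun x t => D t * v x t)).
{ intros v Hv x t.
  apply (continuous_mult (fun p : R * R => D (snd p)) (fun p => v (fst p) (snd p)));
    [|apply Hv].
  apply (continuous_comp snd D); [apply continuous_snd | apply CD]. }
assert (Cmc : jointly_continuous (fun x t => -1 * ca x t)).
{ intros x t; apply (continuous_scal_r (-1) (fun p : R * R => ca (fst p) (snd p))), Cc. }
assert (Hlim : uniform_limit_at_infinity (fun x t => D t * k x (Rabs t))
  (circle_mean (fun x => D 0 * k x (Rabs 0)) + - l)).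
{ apply heat_convergence with (f := fun x t => D t * (-1 * ca x t)) (m := m) (K := k0 0);
    auto.
  - apply CDp, continuous_circle_time_Rabs, (sol_continuous k_solution).
  - intros t x; f_equal; apply (sol_periodic k_solution), Rabs_pos.
  - intros t x; do 2 f_equal; apply Pc.
  - apply discounted_heat_solution with k0; auto.
  - intros x t _; unfold m.
    destruct (circle_max_spec (Pc t) (CcX t)) as [_ Hmax].
    specialize (Hmax x); simpl in Hmax.
    specialize (ca_pos x t); specialize (D_pos t); nra.
  - intros e He; destruct (Hl e He) as [T [HT H]]; exists T; split; auto.
    intros t Ht; specialize (H t Ht).
    rewrite (RInt_ext _ (fun s => opp (g s))).
    + rewrite (RInt_opp g) by (apply ex_RInt_everywhere_continuous; auto).
      unfold opp; simpl; apply Rabs_def1; lra.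
    + intros s _; rewrite circle_mean_scal
        by exact (fun x => jointly_continuous_l _ s x Cmc).
      rewrite circle_mean_scal by auto; unfold g, opp; simpl; ring. }
assert (E0 : circle_mean (fun x => D 0 * k x (Rabs 0)) = circle_mean k0).
{ apply circle_mean_ext; intros x; rewrite Rabs_R0, (sol_init k_solution).
  unfold D, discount; rewrite RInt_point; unfold zero; simpl.
  rewrite Ropp_0, exp_0; ring. }
rewrite E0 in Hlim.
intros eps Heps; destruct (Hlim eps Heps) as [T [HT H]]; exists T; split; auto.
intros t Ht x; specialize (H t Ht x).
rewrite (Rabs_right t) in H by lra; unfold D in H; rewrite discount_Rabs in H by lra.
replace (k x t * discount A t - (circle_mean k0 - l))
  with (discount A t * k x t - (circle_mean k0 + - l)) by ring.
exact H.
Qed.
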